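(* Let $\kappa_1,\kappa_2>0$ and $\alpha\in(0,1)$. There exist constants $K_1,K_2>0$, depending only on $\kappa_1,\kappa_2,\alpha$, such that the following holds. Let $f_0\in C^0(\mathbb{R},\mathbb{R})$ satisfy, for all $y\in\mathbb{R}$, $$\frac{\kappa_2}{(1+|y|)^{\alpha}}\geqslant f_0(y)\geqslant\frac{\kappa_1}{(1+|y|)^{\alpha}},$$ and let $f$ be the solution of the heat equation $\partial_t f-\partial_x^2 f=0$ on $\mathbb{R}$ with initial data $f_0$. Then for all $t\geqslant 0$, $$\frac{K_1}{(1+t)^{\frac{\alpha}{2}}}\leqslant\|f(\cdot,t)\|_{L^\infty(\mathbb{R})}\leqslant\frac{K_2}{(1+t)^{\frac{\alpha}{2}}}.$$
   Context: The solution of the heat equation with initial data $f_0$ is $f(\cdot,0)=f_0$ and, for $t>0$, $f(x,t)=\frac{1}{\sqrt{4\pi t}}\int_{\mathbb{R}}f_0(y)e^{-\frac{(x-y)^2}{4t}}\,dy$. *)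

(* Defs.v *)
From HB Require Import structures.
From mathcomp Require Import all_boot all_order all_algebra.
From mathcomp Require Import all_classical all_reals all_analysis.

Set Implicit Arguments.
Unset Strict Implicit.
Unset Printing Implicit Defensive.

Import Order.TTheory GRing.Theory Num.Theory.
Import numFieldNormedType.Exports.

Local Open Scope classical_set_scope.
Local Open Scope ring_scope.

(* The solution of the heat equation on the line with initial data f0, given by
   convolution with the heat kernel. Only t >= 0 is meaningful: the last branch
   is the initial condition at t = 0. *)
Definition heat_solution (R : realType) (f0 : R -> R) (x t : R) : R :=
  if 0 < t then
    (Num.sqrt (4 * pi * t))^-1 *
      \int[@lebesgue_measure R]_y (f0 y * expR (- ((x - y) ^+ 2 / (4 * t))))
  else f0 x.

(* Main.v *)
Require Import Defs.
From HB Require Import structures.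
From mathcomp Require Import all_boot all_order all_algebra.
From mathcomp Require Import all_classical all_reals all_analysis.
From mathcomp Require Import ess_sup_inf measurable_realfun ring lra.

Set Implicit Arguments.
Unset Strict Implicit.
Unset Printing Implicit Defensive.

Import Order.TTheory GRing.Theory Num.Theory.
Import numFieldNormedType.Exports.

Local Open Scope classical_set_scope.
Local Open Scope ring_scope.

(** Diffusion during a time [t] mixes the data over distances of order
    [s = sqrt t], so the solution near the origin has the size of the average
    of [f0] over [[- s, s]].  Since [alpha < 1], the function [|y|^-alpha] is
    locally integrable at the origin, and its average over [[- s, s]] is
    comparable with its value [s^-alpha] at distance [s].

    To make this uniform in [t >= 0], the weight [(1 + |y|)^-alpha] is replaced
    by the smooth weight [w y = (1 + y^2)^(-alpha/2)], which is comparable with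
    it ([le_bracket_pow], [ge_bracket_pow]) and for which [w (sqrt t)] is
    exactly the rate [(1 + t)^(-alpha/2)].

    Upper bound ([heat_solution_le]): outside [[- s, s]] the data are at most
    [kappa2 * w s] and the heat kernel has mass one; inside, the kernel is at
    most [1 / (2 s)] and the integral of [w] is at most
    [2 s * w s / (1 - alpha)] ([Rintegral_bracket_pow_le]).  The two
    contributions are both multiples of [w s].

    Lower bound ([heat_solution_ge]): for [x] and [y] both in [[0, s]] the
    kernel is at least a constant times [1 / s] and the data are at least
    [kappa1 / 2 * w s]; integrating over [y] in [[0, s]] bounds the solution
    from below on the whole interval [[0, s]], hence bounds its essential
    supremum.  At [t = 0] this interval is a point, and the interval [[0, 1]]
    is used instead. *)

(** * Essential supremum norm and restriction of integrals *)

Section Lnorm_pinfty.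
Context d (T : measurableType d) (R : realType).
Variable mu : {measure set T -> \bar R}.
Implicit Types (f : T -> \bar R) (c : \bar R) (D : set T).
Local Open Scope ereal_scope.

Lemma Lnorm_pinfty_le f c : 0 <= c -> (forall x, `|f x| <= c) ->
  'N[mu]_+oo[f] <= c.
Proof.
move=> c0 fc; rewrite unlock /Lnorm; case: ifPn => // _.
by apply/ess_supP; exact: nearW.
Qed.

(** If the norm were below [c], then [D] would lie in the null set where [|f|]
    exceeds its essential supremum. *)
Lemma Lnorm_pinfty_ge f c D : measurable D -> 0 < mu D ->
  (forall x, D x -> c <= `|f x|) -> c <= 'N[mu]_+oo[f].
Proof.
move=> mD D0 cf; rewrite unlock /Lnorm.
rewrite (lt_le_trans D0) ?le_measure ?inE// leNgt; apply/negP => ltc.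
have /(measure_negligible mD) muD : mu.-negligible D.
  apply: negligibleS (ess_sup_ge mu (abse \o f)) => x Dx /= fx.
  by have := le_lt_trans (le_trans (cf _ Dx) fx) ltc; rewrite ltxx.
by rewrite muD ltxx in D0.
Qed.
End Lnorm_pinfty.

Lemma ge0_subset_Rintegral d (T : measurableType d) (R : realType)
    (mu : {measure set T -> \bar R}) (A B : set T) (f : T -> R) :
  measurable A -> measurable B -> mu.-integrable B (EFin \o f) ->
  (forall x, B x -> 0 <= f x) -> A `<=` B ->
  \int[mu]_(x in A) f x <= \int[mu]_(x in B) f x.
Proof.
move=> mA mB intf f0 AB; apply: fine_le.
- exact: integrable_fin_num (integrableS mB mA AB intf).
- exact: integrable_fin_num intf.
- apply: ge0_subset_integral => //; exact: measurable_int intf.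
Qed.

(** * Powers of the Japanese bracket *)

(** The power [<y>^-alpha] of the Japanese bracket [<y> = (1 + y^2)^(1/2)]:
    unlike [(1 + |y|)^-alpha] it is differentiable at the origin. *)
Definition bracket_pow (R : realType) (alpha y : R) : R :=
  (1 + y ^+ 2) `^ (- (alpha / 2)).

Section bracket_pow_theory.
Context {R : realType}.
Implicit Types alpha y z : R.
Local Notation w := bracket_pow.

Lemma bracket_pow_gt0 alpha y : 0 < w alpha y.
Proof. by apply: powR_gt0; rewrite ltr_wpDr ?sqr_ge0. Qed.

Lemma bracket_pow_le alpha y z : 0 <= alpha -> y ^+ 2 <= z ^+ 2 ->
  w alpha z <= w alpha y.
Proof.
move=> a0 yz; rewrite /bracket_pow !powRN lef_pV2 ?posrE; last 2 first.
- by apply: powR_gt0; rewrite ltr_wpDr ?sqr_ge0.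
- by apply: powR_gt0; rewrite ltr_wpDr ?sqr_ge0.
by apply: ge0_ler_powR; rewrite ?nnegrE ?divr_ge0 ?addr_ge0 ?sqr_ge0// lerD2l.
Qed.

Lemma powR_halfK alpha y : 0 <= y -> (y ^+ 2) `^ (alpha / 2) = y `^ alpha.
Proof.
by move=> y0; rewrite -powR_mulrn// -powRrM mulrCA mulfV ?mulr1.
Qed.

(** Because [1 + y^2 <= (1 + |y|)^2]. *)
Lemma le_bracket_pow alpha y : 0 <= alpha ->
  ((1 + `|y|) `^ alpha)^-1 <= w alpha y.
Proof.
move=> a0; rewrite /bracket_pow powRN
  -(powR_halfK _ (y := 1 + `|y|)) ?addr_ge0//.
rewrite lef_pV2 ?posrE ?powR_gt0 ?exprn_gt0 ?ltr_wpDr ?sqr_ge0//.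
apply: ge0_ler_powR; rewrite ?nnegrE ?divr_ge0 ?addr_ge0 ?sqr_ge0//.
by rewrite -(real_normK (num_real y)); have := normr_ge0 y; nra.
Qed.

(** Because [(1 + |y|)^2 <= 2 (1 + y^2)], and [2^(alpha/2) <= 2]. *)
Lemma ge_bracket_pow alpha y : 0 <= alpha <= 2 ->
  w alpha y / 2 <= ((1 + `|y|) `^ alpha)^-1.
Proof.
move=> /andP[a0 a2]; rewrite /bracket_pow powRN
  -(powR_halfK _ (y := 1 + `|y|)) ?addr_ge0//.
rewrite -invfM lef_pV2 ?posrE ?mulr_gt0 ?powR_gt0 ?exprn_gt0 ?ltr_wpDr
  ?sqr_ge0//.
apply: (@le_trans _ _ ((2 * (1 + y ^+ 2)) `^ (alpha / 2))).
  apply: ge0_ler_powR; rewrite ?nnegrE ?divr_ge0 ?mulr_ge0 ?addr_ge0 ?sqr_ge0//.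
  by rewrite -(real_normK (num_real y)); have := sqr_ge0 (1 - `|y|); nra.
rewrite powRM ?addr_ge0 ?sqr_ge0// mulrC.
rewrite ler_pM2l ?powR_gt0 ?ltr_wpDr ?sqr_ge0//.
by rewrite ler1_powR//; lra.
Qed.

Lemma is_derive_id_bracket_pow alpha y :
  is_derive y 1 (fun z => z * w alpha z)
    (w alpha y * (1 - alpha * (y ^+ 2 / (1 + y ^+ 2)))).
Proof.
have y0 : 0 < 1 + y ^+ 2 by rewrite ltr_wpDr ?sqr_ge0.
have dw : is_derive y 1 (w alpha)
    (- (alpha / 2) * (1 + y ^+ 2) `^ (- (alpha / 2) - 1) * (2 * y)).
  apply: (@is_derive1_comp R (fun z => z `^ (- (alpha / 2)))
    (fun z : R => 1 + z ^+ 2) y _ _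
    (is_derive1_powR (R := R) (- (alpha / 2)) y0)).
  apply: is_derive_eq; rewrite /GRing.scale /=; ring.
apply: is_derive_eq; rewrite /GRing.scale /=.
rewrite powRB ?(lt0r_neq0 y0) ?implybT// powRr1 ?ltW// -/(bracket_pow _ _).
by field; rewrite gt_eqF.
Qed.

Lemma continuous_bracket_pow alpha : continuous (w alpha).
Proof.
move=> y; apply: differentiable_continuous; apply/derivable1_diffP.
have y0 : 0 < 1 + y ^+ 2 by rewrite ltr_wpDr ?sqr_ge0.
apply: ex_derive.
exact: (@is_derive1_comp R (fun z => z `^ (- (alpha / 2)))
  (fun z : R => 1 + z ^+ 2) y _ _
  (is_derive1_powR (R := R) (- (alpha / 2)) y0)).
Qed.

(** The function [y * w y] is almost an antiderivative of [w]: the factor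
    [1 - alpha * y^2 / (1 + y^2)] between its derivative and [w] is at least
    [1 - alpha], which is where [alpha < 1] enters.  Thus [w] can be integrated
    up to a constant without splitting at the origin or near infinity. *)
Lemma Rintegral_bracket_pow_le alpha a : 0 < a -> 0 <= alpha < 1 ->
  \int[lebesgue_measure]_(y in `[- a, a]) w alpha y
    <= 2 * a * w alpha a / (1 - alpha).
Proof.
move=> a0 /andP[al0 al1].
pose F z := z * w alpha z.
pose f (y : R) := w alpha y * (1 - alpha * (y ^+ 2 / (1 + y ^+ 2))).
have cf : continuous f.
  move=> y; apply: continuousM; first exact: continuous_bracket_pow.
  apply: continuousB; first exact: cvg_cst.
  apply: continuousM; first exact: cvg_cst.
  apply: continuousM; first exact: exprn_continuous.
  apply: continuousV; first by rewrite gt_eqF// ltr_wpDr ?sqr_ge0.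
  apply: continuousD; first exact: cvg_cst.
  exact: exprn_continuous.
have dF y : derivable F y 1.
  by apply: ex_derive; exact: is_derive_id_bracket_pow.
have cF : continuous F.
  by move=> y; apply: differentiable_continuous; apply/derivable1_diffP.
have intC (g : R -> R) : continuous g ->
    lebesgue_measure.-integrable `[- a, a] (EFin \o g).
  move=> cg; apply: continuous_compact_integrable; first exact: segment_compact.
  exact: continuous_subspaceT.
have intf : \int[lebesgue_measure]_(y in `[- a, a]) f y = 2 * a * w alpha a.
  rewrite /Rintegral (@continuous_FTC2 _ f F); last 4 first.
  - by rewrite gtrN.
  - exact: continuous_subspaceT.
  - split; [by move=> y _; exact: dF | | ].
    + by apply: cvg_at_right_filter; exact: cF.
    + by apply: cvg_at_left_filter; exact: cF.
  - by move=> y _; rewrite derive1E;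
    have [_ ->] := is_derive_id_bracket_pow alpha y.
  by rewrite /= /F /bracket_pow sqrrN; ring.
rewrite -intf ler_pdivlMr ?subr_gt0// -RintegralZr//; last first.
  exact/intC/continuous_bracket_pow.
apply: le_Rintegral => //.
- apply: intC => y; apply: continuousM; first exact: continuous_bracket_pow.
  exact: cvg_cst.
- exact: intC.
move=> y _; rewrite /f ler_pM2l ?bracket_pow_gt0// lerB// ler_piMr//.
by rewrite ler_pdivrMr ?mul1r ?ltr_wpDr ?sqr_ge0// lerDr.
Qed.
End bracket_pow_theory.

(** * The heat kernel and the solution *)

Section heat_kernel.
Context {R : realType}.
Implicit Types x t k alpha : R.
Local Notation mu := (@lebesgue_measure R).

(** The heat kernel at time [t] is the density of the normal law of variance
    [2 t], so that its total mass is already known. *)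
Definition heat_kernel x t : R -> R := normal_pdf x (Num.sqrt (2 * t)).

Lemma heat_kernelE x t y : 0 < t -> heat_kernel x t y =
  (Num.sqrt (4 * pi * t))^-1 * expR (- ((x - y) ^+ 2 / (4 * t))).
Proof.
move=> t0; have t2 : 0 <= 2 * t by rewrite mulr_ge0// ltW.
rewrite /heat_kernel normal_pdfE ?sqrtr_eq0 -?ltNge ?mulr_gt0//.
rewrite /normal_peak /normal_fun sqr_sqrtr// mulNr -sqrrN opprB.
by congr ((Num.sqrt _)^-1 * expR (- (_ / _))); rewrite -mulr_natl; ring.
Qed.

Lemma heat_kernel_ge0 x t y : 0 <= heat_kernel x t y.
Proof. exact: normal_pdf_ge0. Qed.

(** The peak of the kernel is [1 / sqrt (4 pi t)]; the bound only keeps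
    [1 <= pi]. *)
Lemma heat_kernel_le x t y : 0 < t -> heat_kernel x t y <= (2 * Num.sqrt t)^-1.
Proof.
move=> t0; rewrite heat_kernelE//.
apply: (@le_trans _ _ (Num.sqrt (4 * pi * t))^-1).
  rewrite ler_piMr ?invr_ge0// -expR0 ler_expR oppr_le0.
  by rewrite mulr_ge0 ?sqr_ge0// invr_ge0 mulr_ge0// ltW.
have pi2 := @pi_ge2 R.
have pit : 0 < 4 * pi * t by rewrite !mulr_gt0// pi_gt0.
rewrite lef_pV2 ?posrE ?mulr_gt0 ?sqrtr_gt0//.
rewrite -[leLHS]ger0_norm ?mulr_ge0// -sqrtr_sqr ler_sqrt ?exprMn
  ?sqr_sqrtr ?ltW//.
nra.
Qed.

Lemma integrable_mul_heat_kernel (f0 : R -> R) k x t : continuous f0 ->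
  (forall y, `|f0 y| <= k) ->
  mu.-integrable setT (EFin \o (f0 \* heat_kernel x t)).
Proof.
move=> cf fk.
apply: (@le_integrable _ _ _ mu setT measurableT _
  (fun y => k%:E * (heat_kernel x t y)%:E)%E).
- apply/measurable_EFinP/measurable_funM; last exact: measurable_normal_pdf.
  exact: continuous_measurable_fun.
- move=> y _ /=; rewrite lee_fin !normrM ler_wpM2r//.
  by rewrite (le_trans (fk y)) ?ler_norm.
- by apply: integrableZl => //; exact: integrable_normal_pdf.
Qed.

Lemma heat_solutionE (f0 : R -> R) x t : 0 < t ->
  mu.-integrable setT (EFin \o (f0 \* heat_kernel x t)) ->
  heat_solution f0 x t = \int[mu]_y (f0 y * heat_kernel x t y).
Proof.
move=> t0 intf; rewrite /heat_solution t0.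
have c0 : Num.sqrt (4 * pi * t) != 0.
  by rewrite lt0r_neq0// sqrtr_gt0 !mulr_gt0// pi_gt0.
rewrite [X in _ * X](_ : _ = Num.sqrt (4 * pi * t) *
    \int[mu]_y (f0 y * heat_kernel x t y)); first by rewrite mulKf.
rewrite -RintegralZl//; apply: eq_Rintegral => y _.
by rewrite heat_kernelE// mulrCA mulVKf.
Qed.

Lemma heat_solution_ge0 (f0 : R -> R) x t :
  (forall y, 0 <= f0 y) -> 0 <= heat_solution f0 x t.
Proof.
move=> f0_ge0; rewrite /heat_solution; case: ifP => // _.
rewrite mulr_ge0 ?invr_ge0//; apply: Rintegral_ge0 => y _.
by rewrite mulr_ge0 ?expR_ge0.
Qed.

(** With [s = sqrt t], the product of the data and the kernel is pointwise at
    most [A] times the kernel when [s < |y|] and at most [B * w y] when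
    [|y| <= s], where [A = k * w s] and [B = k / (2 s)]. *)
Lemma heat_solution_le (f0 : R -> R) k alpha x t : 0 < t -> 0 <= alpha < 1 ->
  continuous f0 -> (forall y, 0 <= f0 y <= k * bracket_pow alpha y) ->
  heat_solution f0 x t
    <= k * (1 + (1 - alpha)^-1) * bracket_pow alpha (Num.sqrt t).
Proof.
move=> t0 /andP[al0 al1] cf fk; set s := Num.sqrt t.
have s0 : 0 < s by rewrite sqrtr_gt0.
have k0 : 0 <= k.
  have /andP[f00 /(le_trans f00)] := fk 0.
  by rewrite pmulr_lge0// bracket_pow_gt0.
have intf : mu.-integrable setT (EFin \o (f0 \* heat_kernel x t)).
  apply: (integrable_mul_heat_kernel _ _ cf
    (k := k * bracket_pow alpha 0)) => y.
  have /andP[f00 fky] := fk y; rewrite ger0_norm// (le_trans fky)//.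
  by rewrite ler_wpM2l// bracket_pow_le// expr0n sqr_ge0.
rewrite heat_solutionE//.
have intw : mu.-integrable `[- s, s] (EFin \o bracket_pow alpha).
  apply: continuous_compact_integrable; first exact: segment_compact.
  exact/continuous_subspaceT/continuous_bracket_pow.
have intwT : mu.-integrable setT (EFin \o (bracket_pow alpha \_ `[- s, s])).
  by rewrite -restrict_EFin; apply/integrable_restrict => //; rewrite setTI.
have intk : mu.-integrable setT (EFin \o heat_kernel x t).
  exact: integrable_normal_pdf.
pose A := k * bracket_pow alpha s; pose B := k * (2 * s)^-1.
have intA : mu.-integrable setT (EFin \o (fun y => A * heat_kernel x t y)).
  exact: (integrableZl measurableT A intk).
have intB : mu.-integrable setT
    (EFin \o (fun y => B * (bracket_pow alpha \_ `[- s, s]) y)).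
  exact: (integrableZl measurableT B intwT).
apply: (@le_trans _ _ (\int[mu]_y
    (A * heat_kernel x t y + B * (bracket_pow alpha \_ `[- s, s]) y))).
  apply: le_Rintegral => //; first exact: (integrableD measurableT intA intB).
  move=> y _; have /andP[f00 fky] := fk y; have G0 := heat_kernel_ge0 x t y.
  have w0 := bracket_pow_gt0 alpha s; have wy0 := bracket_pow_gt0 alpha y.
  rewrite patchE; case: ifPn => [ys|].
    rewrite ler_wpDl ?mulr_ge0 ?(ltW w0)//.
    apply: (le_trans (ler_wpM2r G0 fky)).
    rewrite /B mulrAC (ler_wpM2r (ltW wy0))// ler_wpM2l//.
    exact: heat_kernel_le.
  rewrite notin_setE/= in_itv/= => /negP; rewrite -ler_norml -ltNge => sy.
  (* the restriction of a function takes the default value 0 outside *)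
  rewrite [point](_ : _ = 0)// mulr0 addr0 ler_wpM2r//.
  rewrite (le_trans fky)// ler_wpM2l// bracket_pow_le//.
  by rewrite -[leRHS]real_normK ?num_real// lerXn2r ?nnegrE ?(ltW s0)// ltW.
rewrite RintegralD// !RintegralZl// -Rintegral_mkcond.
rewrite {1}/Rintegral integral_normal_pdf /= mulr1.
apply: (@le_trans _ _ (A + B * (2 * s * bracket_pow alpha s / (1 - alpha)))).
  have B0 : 0 <= B by rewrite mulr_ge0// invr_ge0 mulr_ge0// ltW.
  rewrite lerD2l (ler_wpM2l B0)//.
  by apply: Rintegral_bracket_pow_le => //; exact/andP.
rewrite le_eqVlt; apply/orP; left; apply/eqP; rewrite /A /B.
by field; rewrite subr_eq0 gt_eqF//= gt_eqF.
Qed.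

(** Only the part of the integral over [[0, s]], [s = sqrt t], is kept: there
    [|x - y| <= s], so the Gaussian factor is at least [exp (- 1/4)], and the
    decreasing weight is at least [w s].  The upper bound [M] serves to make
    the integrand integrable. *)
Lemma heat_solution_ge (f0 : R -> R) k M alpha x t :
  0 < t -> 0 <= alpha -> 0 <= k ->
  continuous f0 -> (forall y, k * bracket_pow alpha y <= f0 y <= M) ->
  0 <= x <= Num.sqrt t ->
  k * (expR (- 4^-1) / (2 * Num.sqrt pi)) * bracket_pow alpha (Num.sqrt t)
    <= heat_solution f0 x t.
Proof.
move=> t0 al0 k0 cf fk /andP[x0]; set s := Num.sqrt t => xs.
have s0 : 0 < s by rewrite sqrtr_gt0.
have f0_ge0 y : 0 <= f0 y.
  have /andP[+ _] := fk y; apply: le_trans; rewrite mulr_ge0//.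
  exact/ltW/bracket_pow_gt0.
have intf : mu.-integrable setT (EFin \o (f0 \* heat_kernel x t)).
  apply: (integrable_mul_heat_kernel _ _ cf (k := M)) => y.
  by rewrite ger0_norm//; have /andP[] := fk y.
rewrite heat_solutionE//.
have sE : s ^+ 2 = t by rewrite sqr_sqrtr// ltW.
have piE : Num.sqrt (4 * pi * t) = 2 * Num.sqrt pi * s.
  rewrite -sE -[in LHS](sqr_sqrtr (pi_ge0 R)).
  have -> : 4 * Num.sqrt pi ^+ 2 * s ^+ 2 = (2 * Num.sqrt pi * s) ^+ 2 by ring.
  by rewrite sqrtr_sqr ger0_norm// !mulr_ge0// ltW.
have p0 : 0 < Num.sqrt (pi : R) by rewrite sqrtr_gt0 pi_gt0.
pose c := k * bracket_pow alpha s * ((2 * Num.sqrt pi * s)^-1 * expR (- 4^-1)).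
apply: (@le_trans _ _ (\int[mu]_(y in `[0, s]) c)).
  rewrite Rintegral_cst//= lebesgue_measure_itv/= lte_fin s0/= subr0 /c.
  rewrite le_eqVlt; apply/orP; left; apply/eqP.
  by field; rewrite !gt_eqF.
apply: (@le_trans _ _ (\int[mu]_(y in `[0, s]) (f0 y * heat_kernel x t y)));
  last first.
  apply: ge0_subset_Rintegral => // y _.
  by rewrite mulr_ge0// heat_kernel_ge0.
apply: le_Rintegral => //.
- apply: continuous_compact_integrable; first exact: segment_compact.
  exact/continuous_subspaceT/cst_continuous.
- exact: integrableS intf.
move=> y /=; rewrite in_itv/= => /andP[y0 ys].
rewrite heat_kernelE// piE /c; apply: ler_pM.
- by rewrite mulr_ge0// ltW// bracket_pow_gt0.
- by rewrite mulr_ge0 ?expR_ge0// invr_ge0 !mulr_ge0// ltW.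
- have /andP[+ _] := fk y; apply: le_trans.
  rewrite ler_wpM2l// bracket_pow_le//.
  by rewrite lerXn2r ?nnegrE// ltW.
- rewrite ler_wpM2l ?invr_ge0 ?mulr_ge0 ?(ltW s0)//.
  rewrite ler_expR lerN2 ler_pdivrMr ?mulr_gt0// mulKf// -sE; nra.
Qed.

End heat_kernel.

(** * Decay rate *)

Theorem proposition1p2 (R : realType) (kappa1 kappa2 alpha : R)
    (hkappa1 : 0 < kappa1) (hkappa2 : 0 < kappa2)
    (halpha : 0 < alpha < 1) :
  exists K1 K2 : R, [/\ 0 < K1, 0 < K2 &
    forall f0 : R -> R, continuous f0 ->
      (forall y : R, kappa1 / (1 + `|y|) `^ alpha <= f0 y
                     <= kappa2 / (1 + `|y|) `^ alpha) ->
      forall t : R, 0 <= t ->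
        ((K1 / (1 + t) `^ (alpha / 2))%:E
          <= 'N[@lebesgue_measure R]_+oo
               [(fun x : R => (heat_solution f0 x t)%:E)]
          <= (K2 / (1 + t) `^ (alpha / 2))%:E)%E].
Proof.
have /andP[/ltW al0 al1] := halpha.
pose c : R := expR (- 4^-1) / (2 * Num.sqrt pi).
have sqrtpi1 : 1 <= Num.sqrt (pi : R).
  by rewrite -[leLHS]sqrtr1 ler_sqrt ?pi_ge0// (le_trans _ (pi_ge2 R))// ler1n.
have c0 : 0 < c.
  by rewrite divr_gt0 ?expR_gt0// mulr_gt0// (lt_le_trans ltr01).
have c1 : c <= 1.
  rewrite ler_pdivrMr ?mul1r ?mulr_gt0// ?(lt_le_trans ltr01)//.
  apply: (@le_trans _ _ 1); last by lra.
  by rewrite -expR0 ler_expR oppr_le0 invr_ge0.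
exists (kappa1 / 2 * c), (kappa2 * (1 + (1 - alpha)^-1)); split.
- by rewrite mulr_gt0// divr_gt0.
- by rewrite mulr_gt0// ltr_wpDr// invr_ge0 subr_ge0 ltW.
move=> f0 cf f0_bounds t t0.
have f0_le y : f0 y <= kappa2 * bracket_pow alpha y.
  have /andP[_ /le_trans] := f0_bounds y; apply.
  by rewrite ler_pM2l// le_bracket_pow.
have f0_ge y : kappa1 / 2 * bracket_pow alpha y <= f0 y.
  have /andP[+ _] := f0_bounds y; apply: le_trans.
  rewrite -mulrA ler_pM2l// mulrC; apply: ge_bracket_pow.
  by rewrite al0 (le_trans (ltW al1))// ler1n.
have f0_ge0 y : 0 <= f0 y.
  apply: le_trans (f0_ge y); rewrite mulr_ge0 ?divr_ge0 ?(ltW hkappa1)//.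
  exact/ltW/bracket_pow_gt0.
have wE : ((1 + t) `^ (alpha / 2))^-1 = bracket_pow alpha (Num.sqrt t).
  by rewrite /bracket_pow powRN sqr_sqrtr.
rewrite !wE; apply/andP; split.
  (* the solution is bounded below on [0, sqrt t], and the data on [0, 1] *)
  pose b : R := if 0 < t then Num.sqrt t else 1.
  have b0 : 0 < b by rewrite /b; case: ifPn => // ?; rewrite sqrtr_gt0.
  have mub : (0 < @lebesgue_measure R `[0%R, b])%E.
    by rewrite lebesgue_measure_itv/= lte_fin b0 sube0 lte_fin.
  apply: (Lnorm_pinfty_ge _ mub) => //.
  move=> x /=; rewrite in_itv/= => /andP[x0 xb].
  rewrite lee_fin ger0_norm ?heat_solution_ge0//.
  move: xb; rewrite /b; case: ifPn => [t_gt0 xs|].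
    apply: (@heat_solution_ge _ _ _ (kappa2 * bracket_pow alpha 0)) => //.
    - by rewrite divr_ge0// ltW.
    - move=> y; rewrite f0_ge (le_trans (f0_le y))// ler_pM2l//.
      by rewrite bracket_pow_le// expr0n sqr_ge0.
    - by rewrite x0.
  rewrite -leNgt => t_le0 x1; have -> : t = 0 by apply/le_anti/andP.
  rewrite /heat_solution ltxx sqrtr0 /bracket_pow expr0n addr0 powR1 mulr1.
  have /andP[+ _] := f0_bounds x; apply: le_trans.
  rewrite -mulrA ler_pM2l// (@le_trans _ _ 2^-1) ?ler_piMr//.
  rewrite lef_pV2 ?posrE ?powR_gt0 ?ltr_wpDr// ger0_norm//.
  apply: (@le_trans _ _ (1 + x)); last by lra.
  by rewrite ler1_powR ?lerDl// ltW.
apply: Lnorm_pinfty_le => [|x].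
  rewrite lee_fin !mulr_ge0 ?(ltW hkappa2) ?addr_ge0 ?invr_ge0 ?subr_ge0//.
    exact: ltW.
  exact/ltW/bracket_pow_gt0.
rewrite lee_fin ger0_norm ?heat_solution_ge0//.
have [t_gt0|t_le0] := ltP 0 t.
  by apply: heat_solution_le => // [|y]; apply/andP; split.
have -> : t = 0 by apply/le_anti/andP.
rewrite /heat_solution ltxx sqrtr0; apply: (le_trans (f0_le x)).
apply: ler_pM; rewrite ?(ltW hkappa2) ?(ltW (bracket_pow_gt0 _ _))//.
  by rewrite ler_peMr ?(ltW hkappa2)// lerDl invr_ge0 subr_ge0 ltW.
by rewrite bracket_pow_le// expr0n sqr_ge0.
Qed.
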